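(* Let $v\in C^2(\mathbb{R}^d)$ be a function such that $\nabla v\in C^1_\sharp(Y_d)^d$ and $$\#\left\{x\in Y_d:\nabla v(x)=\overline{\nabla v}\right\}<\infty,\qquad\text{where } \overline{\nabla v}:=\int_{Y_d}\nabla v(y)\,dy.$$ Let $F=F(x,\xi)\in C^1_\sharp(Y_d;C^1(\mathbb{R}^d))^d$ be a vector-valued function satisfying $$\forall\,x\in Y_d,\quad F(x,\overline{\nabla v})=0_{\mathbb{R}^d},$$ $$\forall\,(x,\xi,\eta)\in Y_d\times\mathbb{R}^d\times\mathbb{R}^d,\ \xi\neq\eta,\quad \big(F(x,\xi)-F(x,\eta)\big)\cdot(\xi-\eta)>0.$$ Then the vector field $b\in C^1_\sharp(Y_d)^d$ defined by $b(x):=F(x,\nabla v(x))$ for $x\in Y_d$ satisfies $\mathsf{C}_b=\{0_{\mathbb{R}^d}\}$.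
   Context: $Y_d=\mathbb{R}^d/\mathbb{Z}^d$ is the $d$-dimensional torus, identified with $[0,1)^d$. $C^k_\sharp(Y_d)$ is the space of real-valued $\mathbb{Z}^d$-periodic functions in $C^k(\mathbb{R}^d)$. $C^1_\sharp(Y_d;C^1(\mathbb{R}^d))$ is the space of functions $(x,\xi)\mapsto f(x,\xi)$ which are $\mathbb{Z}^d$-periodic and of class $C^1$ in $x$ with values in $C^1(\mathbb{R}^d)$ with respect to the variable $\xi$. For $b\in C^1_\sharp(Y_d)^d$, the flow $X:\mathbb{R}\times\mathbb{R}^d\to\mathbb{R}^d$ associated with $b$ is the solution of $\partial_t X(t,x)=b(X(t,x))$, $t\in\mathbb{R}$, $X(0,x)=x$; it satisfies $X(t,x+\kappa)=X(t,x)+\kappa$ for $\kappa\in\mathbb{Z}^d$, so it induces a flow on $Y_d$. A probability measure $\mu$ on $Y_d$ is invariant for the flow $X$ if $\int_{Y_d}\psi(X(t,y))\,d\mu(y)=\int_{Y_d}\psi(y)\,d\mu(y)$ for all $t\in\mathbb{R}$ and $\psi\in C^0_\sharp(Y_d)$; $\mathscr{I}_b$ denotes the set of these invariant probability measures. The (Herman) rotation set is $\mathsf{C}_b:=\left\{\int_{Y_d}b(y)\,d\mu(y):\mu\in\mathscr{I}_b\right\}\subset\mathbb{R}^d$. *)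

(* Defs.v *)
From HB Require Import structures.
From mathcomp Require Import all_boot all_order all_algebra.
From mathcomp Require Import all_classical all_reals all_analysis.
From mathcomp Require Import measurable_realfun.

Set Implicit Arguments.
Unset Strict Implicit.
Unset Printing Implicit Defensive.

Import Order.TTheory GRing.Theory Num.Theory.
Import numFieldNormedType.Exports.

Local Open Scope classical_set_scope.
Local Open Scope ring_scope.

(* 'rV[R]_d equipped with its Borel sigma-algebra *)
Definition borel_rV (R : realType) (d : nat) : measurableType _ :=
  g_sigma_algebraType (@open 'rV[R]_d).

Lemma open_measurable_rV (R : realType) (d : nat) (U : set 'rV[R]_d) :
  open U -> measurable (U : set (borel_rV R d)).
Proof. exact: sub_sigma_algebra. Qed.

Lemma open_rV_ratball (R : realType) (d : nat) (U : set 'rV[R]_d) : open U ->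
  U = \bigcup_(p in [set p : 'rV[rat]_d * nat |
        ball (map_mx (@ratr R) p.1) p.2.+1%:R^-1 `<=` U])
      ball (map_mx (@ratr R) p.1) p.2.+1%:R^-1.
Proof.
move=> oU; apply/seteqP; split=> [x Ux|x [p /= pU]]; last exact: pU.
have /nbhs_ballP[e /= e0 eU] : nbhs x U by exact: open_nbhs_nbhs.
have [k ke] : exists k, k.+1%:R^-1 *+ 2 < e.
  have e20 : 0 < e / 2 by rewrite divr_gt0.
  have [k _ /(_ _ (leqnn k)) kP] := near_infty_natSinv_lt (PosNum e20).
  by exists k; rewrite -[_ *+ 2]mulr_natr -ltr_pdivlMr ?ltr0n.
have k0 : 0 < k.+1%:R^-1 :> R by rewrite invr_gt0.
have qP (i : 'I_d) : exists q : rat, `|x ord0 i - ratr q| < k.+1%:R^-1.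
  have : x ord0 i - k.+1%:R^-1 < x ord0 i + k.+1%:R^-1.
    by rewrite ltrD2l (lt_trans _ k0)// oppr_lt0.
  move=> /rat_in_itvoo[q]; rewrite in_itv/= => /andP[q1 q2]; exists q.
  by rewrite distrC ltr_distl q1.
pose q := \row_i sval (cid (qP i)).
have qx : ball (map_mx (@ratr R) q) k.+1%:R^-1 x.
  split=> [|i j]; first by [].
  rewrite (ord1 i) !mxE /ball/=.
  by case: cid => /= r; rewrite distrC.
exists (q, k); last exact: qx.
move=> /= y qy; apply: eU.
apply: (le_ball (ltW ke)).
by rewrite mulr2n; apply: ball_triangle qy; exact: ball_sym.
Qed.

Lemma measurable_fun_rV (R : realType) (d : nat) d' (T : measurableType d')
    (f : T -> borel_rV R d) :
  (forall i, measurable_fun setT (fun t => (f t : 'rV[R]_d) ord0 i)) ->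
  measurable_fun setT f.
Proof.
move=> mf.
apply: (@measurability _ _ T (borel_rV R d) setT f (@open 'rV[R]_d) erefl).
move=> _ [U oU <-]; rewrite setTI (open_rV_ratball oU) preimage_bigcup.
rewrite bigcup_mkcond.
apply: countable_bigcupT_measurable => [|p]; first exact: countableP.
case: ifP => // _.
set q := map_mx _ _; set e := p.2.+1%:R^-1.
have -> : f @^-1` ball q e =
    \bigcap_(i in [set: 'I_d]) ((fun t => (f t : 'rV[R]_d) ord0 i) @^-1`
       ball (q ord0 i) e).
  apply/seteqP; split => [t [_ qt] i _ /=|t qt]; first exact: qt.
  split=> [|i j]; first by rewrite invr_gt0.
  by rewrite (ord1 i); exact: qt.
apply: fin_bigcap_measurable => // i _.
by rewrite -[X in measurable X]setTI; apply: mf => //; apply: open_measurable;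
  exact: ball_open.
Qed.

Lemma measurable_coord_rV (R : realType) (d : nat) (i : 'I_d) :
  measurable_fun setT (fun x : borel_rV R d => (x : 'rV[R]_d) ord0 i).
Proof.
apply: (measurability _ (RGenOpens.measurableE R)) => //.
move=> _ [_ [a [b ->] <-]]; rewrite setTI; apply: open_measurable_rV.
apply: (@open_comp 'rV[R]_d R); last exact: interval_open.
by move=> x _; exact: coord_continuous.
Qed.

Definition cons_rV (R : realType) (d : nat) (p : R * borel_rV R d) :
    borel_rV R d.+1 :=
  row_mx (p.1%:M : 'M[R]_1) (p.2 : 'rV[R]_d) : 'rV[R]_(1 + d).

Lemma measurable_cons_rV (R : realType) (d : nat) :
  measurable_fun setT (@cons_rV R d).
Proof.
apply: measurable_fun_rV => i; rewrite /cons_rV.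
have [j ->|j ->] := @split_ordP 1 d i.
  rewrite (_ : (fun _ => _) = fst); first exact: measurable_fst.
  apply/funext => p.
  have := @row_mxEl _ _ 1 d (p.1%:M : 'M[R]_1) (p.2 : 'rV[R]_d) ord0 j.
  by rewrite (ord1 j) [in RHS]mxE eqxx mulr1n.
rewrite (_ : (fun _ => _) = (fun x : borel_rV R d => (x : 'rV[R]_d) ord0 j)
    \o snd).
  by apply: measurableT_comp => //; exact: measurable_coord_rV.
apply/funext => p.
exact: (@row_mxEr _ _ 1 d (p.1%:M : 'M[R]_1) (p.2 : 'rV[R]_d) ord0 j).
Qed.

Fixpoint lebesgue_rV (R : realType) (d : nat) : set (borel_rV R d) -> \bar R :=
  match d with
  | 0 => @dirac _ (borel_rV R 0) (0 : 'rV[R]_0) R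
  | d'.+1 =>
      pushforward (lebesgue_measure \x @lebesgue_rV R d')%E (@cons_rV R d')
  end.

Lemma measurable_box_rV (R : realType) (d : nat) (I : 'I_d -> set R) :
  (forall i, measurable (I i)) ->
  measurable ([set x : 'rV[R]_d | forall i, I i (x ord0 i)] :
    set (borel_rV R d)).
Proof.
move=> mI.
rewrite (_ : mkset _ = \bigcap_(i in [set: 'I_d])
   ((fun x : borel_rV R d => (x : 'rV[R]_d) ord0 i) @^-1` I i)); last first.
  by apply/seteqP; split => x /= xI => [i _|i]; exact: xI.
apply: fin_bigcap_measurable => // i _.
by rewrite -[X in measurable X]setTI; apply: measurable_coord_rV.
Qed.

Lemma preimage_cons_rV_box (R : realType) (d : nat) (I : 'I_d.+1 -> set R) :
  @cons_rV R d @^-1` [set x : 'rV[R]_d.+1 | forall i, I i (x ord0 i)] =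
  I ord0 `*` [set x : 'rV[R]_d | forall i, I (lift ord0 i) (x ord0 i)].
Proof.
have E0 (p : R * borel_rV R d) : (cons_rV p : 'rV[R]_d.+1) ord0 ord0 = p.1.
  have := @row_mxEl _ _ 1 d (p.1%:M : 'M[R]_1) (p.2 : 'rV[R]_d) ord0 ord0.
  rewrite [in RHS]mxE eqxx mulr1n => <-; congr (row_mx _ _ _ _).
  exact/val_inj.
have ES (p : R * borel_rV R d) i :
    (cons_rV p : 'rV[R]_d.+1) ord0 (lift ord0 i) = (p.2 : 'rV[R]_d) ord0 i.
  have <- := @row_mxEr _ _ 1 d (p.1%:M : 'M[R]_1) (p.2 : 'rV[R]_d) ord0 i.
  by congr (row_mx _ _ _ _); exact/val_inj.
apply/seteqP; split => [p /= pI|p [/= pI0 pI] i].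
  by split => [|i]; [have := pI ord0; rewrite E0|have := pI (lift ord0 i);
    rewrite ES].
by have [j ->|->] := unliftP ord0 i; rewrite ?ES ?E0//; exact: pI.
Qed.

Lemma lebesgue_rV_subproof (R : realType) (d : nat) :
  exists mu : {sigma_finite_measure set (borel_rV R d) -> \bar R},
    lebesgue_rV (d := d) = mu :> (set _ -> _) /\
    (forall I : 'I_d -> set R, (forall i, measurable (I i)) ->
      mu [set x : 'rV[R]_d | forall i, I i (x ord0 i)] =
      (\prod_(i < d) lebesgue_measure (I i))%E).
Proof.
elim: d => [|d [m [mE mI]]].
  exists (@dirac _ (borel_rV R 0) (0 : 'rV[R]_0) R); split => // I _.
  by rewrite big_ord0 /= /dirac indicE mem_set//= => -[].
set mu := lebesgue_rV (d := d.+1).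
have muE : mu = pushforward (lebesgue_measure \x m)%E (@cons_rV R d).
  by rewrite /mu /= mE.
have mcons (A : set (borel_rV R d.+1)) : measurable A ->
    measurable (@cons_rV R d @^-1` A).
  by move=> mA; rewrite -[X in measurable X]setTI; exact: measurable_cons_rV.
have mu0 : mu set0 = 0%E.
  by rewrite muE /pushforward preimage_set0 measure0.
have mu_ge0 A : (0 <= mu A)%E.
  by rewrite muE; apply: integral_ge0 => x _; exact: measure_ge0.
have mu_sa : semi_sigma_additive mu.
  rewrite muE => F mF tF mUF; rewrite /pushforward preimage_bigcup.
  apply: measure_semi_sigma_additive.
  - by move=> n; exact: mcons.
  - apply/trivIsetP => /= i j _ _ ij; rewrite -preimage_setI.
    by move/trivIsetP : tF => /(_ _ _ _ _ ij) ->//; rewrite preimage_set0.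
  - by rewrite -preimage_bigcup; exact: mcons.
have muI (I : 'I_d.+1 -> set R) : (forall i, measurable (I i)) ->
    mu [set x : 'rV[R]_d.+1 | forall i, I i (x ord0 i)] =
    (\prod_(i < d.+1) lebesgue_measure (I i))%E.
  move=> mII; rewrite muE /pushforward preimage_cons_rV_box.
  have mII' i : measurable (I (lift ord0 i)) by exact: mII.
  rewrite product_measure1E; first by rewrite big_ord_recl (mI _ mII').
    exact: mII.
  exact: (measurable_box_rV mII').
have mu_sf : sigma_finite setT mu.
  pose K (k : nat) := [set x : 'rV[R]_d.+1 |
    forall i, `[- k%:R, k%:R]%classic (x ord0 i)].
  exists K => [|k].
    apply/seteqP; split => // x _.
    exists (Num.truncn `|x|).+1 => // i /=; rewrite in_itv/= -ler_norml.
    apply: le_trans (ltW (truncnS_gt _)).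
    rewrite [leRHS]/Num.norm /= mx_normrE.
    exact: (le_bigmax _ (fun p => `|x p.1 p.2|) (ord0, i)).
  have mK (i : 'I_d.+1) : measurable `[- (k%:R : R), k%:R] by [].
  split; first exact: (measurable_box_rV mK).
  rewrite /K (muI _ mK).
  suff : (\prod_(i < d.+1) lebesgue_measure `[(- k%:R)%R, (k%:R : R)])%E
      \is a fin_num by rewrite fin_numElt => /andP[].
  elim/big_ind : _ => // [x y|i _]; first exact: fin_numM.
  by rewrite lebesgue_measure_itv/= -EFinB; case: ifP.
pose nu0 : {measure set (borel_rV R d.+1) -> \bar R} :=
  HB.pack mu (isMeasure.Build _ (borel_rV R d.+1) R mu mu0 mu_ge0 mu_sa).
pose nu : {sigma_finite_measure set (borel_rV R d.+1) -> \bar R} :=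
  HB.pack (Measure.sort nu0)
    (Measure_isSigmaFinite.Build _ (borel_rV R d.+1) R nu0 mu_sf).
by exists nu.
Qed.

Section lebesgue_rV_measure.
Context (R : realType) (d : nat).

Let lebesgue_rV0 : lebesgue_rV (d := d) (set0 : set (borel_rV R d)) = 0%E.
Proof. by have [mu [-> _]] := lebesgue_rV_subproof R d. Qed.

Let lebesgue_rV_ge0 (A : set (borel_rV R d)) : (0 <= lebesgue_rV A)%E.
Proof. by have [mu [-> _]] := lebesgue_rV_subproof R d. Qed.

Let lebesgue_rV_sigma_additive : semi_sigma_additive (@lebesgue_rV R d).
Proof.
have [mu [-> _]] := lebesgue_rV_subproof R d.
exact: measure_semi_sigma_additive.
Qed.

Let lebesgue_rV_sigma_finite : sigma_finite setT (@lebesgue_rV R d).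
Proof.
have [mu [-> _]] := lebesgue_rV_subproof R d; exact: sigma_finiteT.
Qed.

HB.instance Definition _ := isMeasure.Build _ _ _ (@lebesgue_rV R d)
  lebesgue_rV0 lebesgue_rV_ge0 lebesgue_rV_sigma_additive.

HB.instance Definition _ := Measure_isSigmaFinite.Build _ _ _
  (@lebesgue_rV R d) lebesgue_rV_sigma_finite.

End lebesgue_rV_measure.

Lemma lebesgue_rV_box (R : realType) (d : nat) (I : 'I_d -> set R) :
  (forall i, measurable (I i)) ->
  lebesgue_rV [set x : 'rV[R]_d | forall i, I i (x ord0 i)] =
  (\prod_(i < d) lebesgue_measure (I i))%E.
Proof. by move=> mI; have [mu [-> ->]] := lebesgue_rV_subproof R d. Qed.

(* fundamental domain [0,1)^d of the torus R^d / Z^d *)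
Definition unit_cube (R : realType) (d : nat) : set 'rV[R]_d :=
  [set x | forall i, 0 <= x ord0 i < 1].

Definition dot (R : realType) (d : nat) (u w : 'rV[R]_d) : R :=
  \sum_(i < d) u ord0 i * w ord0 i.

(* functions on the torus are Z^d-periodic functions on R^d *)
Definition periodic_rV (R : realType) (d : nat) (W : Type)
    (f : 'rV[R]_d -> W) : Prop :=
  forall (x : 'rV[R]_d) (k : 'rV[int]_d), f (x + map_mx intr k) = f x.

(* continuity of x |-> 'd f x, expressed direction by direction; used here with
   V finite dimensional *)
Definition C1 (R : realType) (V W : normedModType R) (f : V -> W) : Prop :=
  (forall x, differentiable f x) /\ (forall h, continuous ('D_h f)).

Definition C1_per (R : realType) (d : nat) (W : normedModType R)
    (f : 'rV[R]_d -> W) : Prop :=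
  C1 f /\ periodic_rV f.

Definition grad (R : realType) (d : nat) (v : 'rV[R]_d -> R) (x : 'rV[R]_d) :
    'rV[R]_d :=
  \row_i 'D_(delta_mx ord0 i) v x.

Definition C2 (R : realType) (d : nat) (v : 'rV[R]_d -> R) : Prop :=
  C1 v /\ C1 (grad v).

(* convergence in the Frechet space C^1(V; W): uniform convergence on compact
   sets of the functions and of their first order derivatives *)
Definition cvg_C1 (R : realType) (V W : normedModType R) (T : Type)
    (Phi : set_system T) (g : T -> V -> W) (l : V -> W) : Prop :=
  {family compact, g t @[t --> Phi] --> l} /\
  forall h, {family compact, 'D_h (g t) @[t --> Phi] --> 'D_h l}.

(* f is of class C^1 in its first variable with values in the Frechet space
   C^1('rV_d): it takes its values in C^1, it has a Frechet derivative
   (necessarily h |-> 'd (f^~ xi) x h) for the topology of that space, and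
   this derivative depends continuously on x *)
Definition C1_C1_per (R : realType) (d : nat)
    (f : 'rV[R]_d -> 'rV[R]_d -> 'rV[R]_d) : Prop :=
  let Df x h := fun xi : 'rV[R]_d => 'd (f^~ xi) x h in
  [/\ periodic_rV f,
      forall x, C1 (f x),
      forall x xi, differentiable (f^~ xi) x,
      forall x h, C1 (Df x h) &
      (forall x, cvg_C1 (nbhs 0)
        (fun h xi => `|h|^-1 *: (f (x + h) xi - f x xi - Df x h xi)) (cst 0)) /\
      (forall h x, cvg_C1 (nbhs x) (Df^~ h) (Df x h))].

Definition is_flow (R : realType) (d : nat) (b : 'rV[R]_d -> 'rV[R]_d)
    (X : R -> 'rV[R]_d -> 'rV[R]_d) : Prop :=
  forall x, X 0 x = x /\
    forall t : R, is_derive t (1 : R) (X^~ x) (b (X t x)).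

(* a probability measure on the torus is a Borel probability measure on R^d
   carried by [0,1)^d *)
Definition torus_probability (R : realType) (d : nat)
    (mu : probability (borel_rV R d) R) : Prop :=
  mu (@unit_cube R d) = 1%E.

Definition invariant_measures (R : realType) (d : nat)
    (X : R -> 'rV[R]_d -> 'rV[R]_d) : set (probability (borel_rV R d) R) :=
  [set mu | torus_probability mu /\
    forall (t : R) (psi : 'rV[R]_d -> R), continuous psi -> periodic_rV psi ->
      \int[mu]_(y in @unit_cube R d) psi (X t y) =
      \int[mu]_(y in @unit_cube R d) psi y].

Definition integral_rV (R : realType) (d m : nat)
    (mu : {measure set (borel_rV R d) -> \bar R}) (A : set 'rV[R]_d)
    (f : 'rV[R]_d -> 'rV[R]_m) : 'rV[R]_m :=
  \row_i \int[mu]_(y in A) (f y ord0 i).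

(* X is meant to be the flow of b *)
Definition rotation_set (R : realType) (d : nat) (b : 'rV[R]_d -> 'rV[R]_d)
    (X : R -> 'rV[R]_d -> 'rV[R]_d) : set 'rV[R]_d :=
  [set integral_rV mu (@unit_cube R d) b | mu in invariant_measures X].

Definition torus_mean (R : realType) (d : nat) (f : 'rV[R]_d -> 'rV[R]_d) :
    'rV[R]_d :=
  integral_rV (@lebesgue_rV R d) (@unit_cube R d) f.

(* Main.v *)
Require Import Defs.
From HB Require Import structures.
From mathcomp Require Import all_boot all_order all_algebra.
From mathcomp Require Import all_classical all_reals all_analysis.
From mathcomp Require Import measurable_realfun ring.

Set Implicit Arguments.
Unset Strict Implicit.
Unset Printing Implicit Defensive.

Import Order.TTheory GRing.Theory Num.Theory.
Import numFieldNormedType.Exports.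

Local Open Scope classical_set_scope.
Local Open Scope ring_scope.

(** Let m be the mean of grad v. The function u x = v x - m . x is periodic: for
    a unit vector e_i the increment v (x + e_i) - v x is constant, since its
    gradient vanishes, and it equals the mean m_i of the i-th partial derivative
    by Fubini's theorem and the fundamental theorem of calculus
    ([corrector_periodic]). Since F x m = 0, strict monotonicity says that

      b x . grad u x = (F x (grad v x) - F x m) . (grad v x - m) > 0

    unless grad v x = m, and then b x = F x m = 0. So u increases along the
    trajectories of b, strictly except at the zeros of b.

    An invariant probability measure gives the same integral to u o X 1 and to
    u o X (-1). The first function dominates the second one, so they are equal
    almost everywhere; u is then constant along the trajectory between the times
    -1 and 1, and this only happens at zeros of b. Thus the measure is carried
    by the zeros of b and b has mean 0 ([invariant_measure_equilibria]).
    Conversely 0 is attained: u has a maximum on the torus, b vanishes there,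
    the trajectory from this point is constant by uniqueness of solutions, and
    the Dirac mass at this point is invariant ([lyapunov_rotation_set]).

    Two analytic facts support this. First, b is of class C^1 ([C1_diag]): the
    regularity of F is stated in the Frechet space C^1(R^d; R^d), whose topology
    of uniform convergence on compact sets permits the evaluation of F, of its
    difference quotients and of their derivatives at the moving point grad v x
    ([family_compact_cvg_diag]). Secondly, b is Lipschitz, being periodic and
    C^1, and Gronwall's inequality makes the flow continuous and the solutions
    unique ([solution_dist]). *)

(** * Limits and differentials in R^d *)

Lemma coord_le_norm (R : realType) (d : nat) (x : 'rV[R]_d) i :
  `|x ord0 i| <= `|x|.
Proof.
rewrite [leRHS]/Num.norm /= mx_normrE.
exact: (le_bigmax _ (fun p => `|x p.1 p.2|) (ord0, i)).
Qed.

Lemma linear_rV_delta (R : realType) (d : nat) (W : normedModType R)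
    (L : {linear 'rV[R]_d -> W}) h :
  L h = \sum_j h ord0 j *: L (delta_mx ord0 j).
Proof.
rewrite [in LHS](row_sum_delta h) linear_sum.
by apply: eq_bigr => j _; rewrite linearZ.
Qed.

Lemma norm_linear_rV_le (R : realType) (d : nat) (W : normedModType R)
    (L : {linear 'rV[R]_d -> W}) h :
  `|L h| <= `|h| * \sum_j `|L (delta_mx ord0 j)|.
Proof.
rewrite [in leLHS]linear_rV_delta mulr_sumr.
apply: (le_trans (ler_norm_sum _ _ _)); apply: ler_sum => j _.
by rewrite normrZ ler_wpM2r// coord_le_norm.
Qed.

(** The differential packaged as a limit of quotients. At h = 0 the quotient is
    0, because the inverse of 0 is 0, so the full neighbourhood filter of 0 can
    be used instead of the punctured one; this is also the shape of the
    difference quotients in [C1_C1_per]. *)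
Lemma diff_from_quotient (R : realType) (V W : normedModType R) (f : V -> W)
    (x : V) (L : {linear V -> W}) :
  continuous L ->
  `|h|^-1 *: (f (h + x) - f x - L h) @[h --> 0] --> (0 : W) ->
  differentiable f x /\ 'd f x = L :> (V -> W).
Proof.
move=> cL fL.
have fo : f \o shift x = cst (f x) + L +o_ (0 : V) id.
  apply/eqaddoP => e e0.
  have /cvgr0Pnorm_le/(_ e e0) := fL.
  apply: filterS => h; rewrite normrZ normfV normr_id => he.
  have [->|h0] := eqVneq h 0.
    rewrite normr0 mulr0 /=.
    rewrite -[(_ - _) _]/(f (0 + x) - (f x + L 0)).
    by rewrite add0r linear0 addr0 subrr normr0.
  rewrite -[(_ - _) _]/(f (h + x) - (f x + L h)) opprD addrA.
  by move: he; rewrite ler_pdivrMl ?normr_gt0// mulrC.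
have dE := diff_unique cL fo.
split => //; apply/diff_locallyP; rewrite dE; split => //.
Qed.

Lemma diff_quotient_cvg0 (R : realType) (V W : normedModType R) (f : V -> W)
    (x : V) :
  differentiable f x ->
  `|h|^-1 *: (f (h + x) - f x - 'd f x h) @[h --> 0] --> (0 : W).
Proof.
move=> /diff_locallyP[_ /eqaddoP fo]; apply/cvgr0Pnorm_le => e e0.
move: (fo _ e0); apply: filterS => h.
rewrite -[(_ - _) _]/(f (h + x) - (f x + 'd f x h)) opprD addrA => he.
rewrite normrZ normfV normr_id.
have [->|h0] := eqVneq h 0; first by rewrite normr0 invr0 mul0r ltW.
by rewrite ler_pdivrMl ?normr_gt0// mulrC.
Qed.

Lemma rV_nbhs_compact (R : realType) (d : nat) (x : 'rV[R]_d) :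
  exists2 K, compact K & nbhs x K.
Proof.
exists (closed_ball x 1); last first.
  by apply/nbhs_closedballP; exists 1%:pos.
apply: bounded_closed_compact; last exact: closed_ball_closed.
exists (`|x| + 1); split => // M xM y.
rewrite closed_ballE// /closed_ball_ /= => xy.
rewrite (le_trans _ (ltW xM))// -[y](subrK x) addrC.
by rewrite (le_trans (ler_normD _ _))// lerD2l distrC.
Qed.

(** Uniform convergence on compact sets is what allows the point of evaluation
    to move: z t eventually stays in one compact neighbourhood of z0, on which
    g t is uniformly close to l. Every use below of the topology of the space
    C^1(R^d; R^d) goes through this lemma. *)
Lemma family_compact_cvg_diag (R : realType) (d : nat) (W : normedModType R)
    (T : Type) (Phi : set_system T) {FPhi : Filter Phi}
    (g : T -> 'rV[R]_d -> W) (l : 'rV[R]_d -> W) (z : T -> 'rV[R]_d) z0 :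
  {family compact, g t @[t --> Phi] --> l} ->
  {for z0, continuous l} -> z t @[t --> Phi] --> z0 ->
  g t (z t) @[t --> Phi] --> l z0.
Proof.
move=> /fam_cvgP gl cl zz0; have [K cK z0K] := rV_nbhs_compact z0.
have {}gl := gl _ cK.
apply/cvgrPdist_lt => e e0.
have e20 : 0 < e / 2 by rewrite divr_gt0.
have gK : \forall t \near Phi, forall y, K y -> `|l y - g t y| < e / 2.
  apply: (gl [set k | forall y, K y -> `|l y - k y| < e / 2]).
  apply/uniform_nbhs; exists [set p | `|p.1 - p.2| < e / 2].
  split=> // ; rewrite -entourage_ballE; exists (e / 2) => //= -[a b] /=.
  by rewrite -ball_normE.
have cz : l (z t) @[t --> Phi] --> l z0 by apply: cvg_comp zz0 cl.
near=> t.
rewrite -[X in X - _](subrK (l (z t))) -addrA (splitr e).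
apply: (le_lt_trans (ler_normD _ _)); apply: ltrD.
  near: t; move/cvgrPdist_lt: cz; exact.
have Kz : K (z t) by near: t; exact: zz0.
by move: (z t) Kz; near: t.
Unshelve. all: by end_near. Qed.

Lemma C1_continuous (R : realType) (V W : normedModType R) (f : V -> W) :
  C1 f -> continuous f.
Proof. by move=> [df _] x; exact: differentiable_continuous. Qed.

Lemma cvg_sum_ord (R : realType) (T : Type) (Phi : set_system T)
    {FPhi : Filter Phi}
    (W : normedModType R) (n : nat) (g : 'I_n -> T -> W) (l : 'I_n -> W) :
  (forall i, g i t @[t --> Phi] --> l i) ->
  \sum_i g i t @[t --> Phi] --> \sum_i l i.
Proof.
move=> gl; rewrite -[X in X @ _]fct_sumE.
by elim/big_ind2 : _ => // [|f a f' a' fa fa']; [exact: cvg_cst|exact: cvgD].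
Qed.

Lemma cvg_coord_scale (R : realType) (d : nat) (T : Type)
    (Phi : set_system T) {FPhi : Filter Phi}
    (W : normedModType R)
    (h : T -> 'rV[R]_d) (h0 : 'rV[R]_d) (g : 'I_d -> T -> W) (l : 'I_d -> W) :
  h t @[t --> Phi] --> h0 -> (forall i, g i t @[t --> Phi] --> l i) ->
  \sum_i h t ord0 i *: g i t @[t --> Phi] --> \sum_i h0 ord0 i *: l i.
Proof.
move=> hh gl; apply: cvg_sum_ord => i; apply: cvgZ => //.
apply: (continuous_cvg _ (h := fun M : 'rV[R]_d => M ord0 i)) => //.
exact: coord_continuous.
Qed.

Lemma cvg_coord_scale0 (R : realType) (d : nat) (T : Type)
    (Phi : set_system T) {FPhi : Filter Phi}
    (W : normedModType R)
    (h : T -> 'rV[R]_d) (g : 'I_d -> T -> W) (l : 'I_d -> W) :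
  h t @[t --> Phi] --> (0 : 'rV[R]_d) ->
  (forall i, g i t @[t --> Phi] --> l i) ->
  \sum_i h t ord0 i *: g i t @[t --> Phi] --> (0 : W).
Proof.
move=> h0 gl.
have E : \sum_i (0 : 'rV[R]_d) ord0 i *: l i = 0.
  by rewrite big1// => i _; rewrite mxE scale0r.
have := cvg_coord_scale (FPhi := FPhi) h0 gl; rewrite E; exact.
Qed.

Lemma cvg_norm_scale0 (R : realType) (T : Type) (Phi : set_system T)
    {FPhi : Filter Phi}
    (V W : normedModType R) (h : T -> V) (g : T -> W) (l : W) :
  h t @[t --> Phi] --> (0 : V) -> g t @[t --> Phi] --> l ->
  `|h t| *: g t @[t --> Phi] --> (0 : W).
Proof.
move=> h0 gl; have := cvgZ (FF := FPhi) (cvg_norm (FF := FPhi) h0) gl.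
by rewrite normr0 scale0r.
Qed.

Lemma cvg_add0 (R : realType) (T : Type) (Phi : set_system T)
    {FPhi : Filter Phi}
    (W : normedModType R) (f g k : T -> W) (l : W) :
  f t @[t --> Phi] --> l -> g t @[t --> Phi] --> (0 : W) ->
  k t @[t --> Phi] --> (0 : W) -> f t + g t + k t @[t --> Phi] --> l.
Proof.
move=> fl g0 k0.
by have := cvgD (FF := FPhi) (cvgD (FF := FPhi) fl g0) k0; rewrite !addr0.
Qed.

Lemma continuous_addmap (R : realType) (V W : normedModType R) (f g : V -> W) :
  continuous f -> continuous g -> continuous (f \+ g).
Proof. by move=> cf cg x; apply: cvgD; [exact: cf|exact: cg]. Qed.

Lemma cvg_sum_dist (R : realType) (T : Type) (Phi : set_system T)
    {FPhi : Filter Phi}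
    (W : normedModType R) (n : nat) (g : 'I_n -> T -> W) (l : 'I_n -> W) :
  (forall i, g i t @[t --> Phi] --> l i) ->
  \sum_i `|g i t - l i| @[t --> Phi] --> (0 : R).
Proof.
move=> gl.
have E : \sum_(i < n) `|l i - l i| = 0 :> R.
  by rewrite big1// => i _; rewrite subrr normr0.
have H i : `|g i t - l i| @[t --> Phi] --> (`|l i - l i| : R).
  by apply: cvg_norm; apply: cvgB => //; exact: cvg_cst.
have := cvg_sum_ord (FPhi := FPhi) (W := R) H; rewrite E; exact.
Qed.

Lemma quotient_cvg0 (R : realType) (V W : normedModType R) (q : V -> W)
    (s : V -> R) :
  (forall h, `|q h| <= `|h| * s h) -> s h @[h --> 0] --> (0 : R) ->
  `|h|^-1 *: q h @[h --> 0] --> (0 : W).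
Proof.
move=> qs s0; apply/cvgr0Pnorm_le => e e0.
move/cvgr0Pnorm_le : s0 => /(_ e e0); apply: filterS => h he.
rewrite normrZ normfV normr_id.
have [->|h0] := eqVneq h 0; first by rewrite normr0 invr0 mul0r ltW.
rewrite ler_pdivrMl ?normr_gt0// (le_trans (qs h))// ler_wpM2l//.
exact: (le_trans (ler_norm _)).
Qed.

(** With G' = G (h + x), this is the bookkeeping for the increment of
    x |-> F x (G x): a, b, c are F (h + x) G', F x G', F x (G x), the terms
    e' and e are the partial differential in x taken at G' and at G x, and k
    is the differential of F x o G. *)
Lemma split_increment (W : zmodType) (a b c e e' k : W) :
  a - c - (e + k) = (a - b - e') + (e' - e) + (b - c - k).
Proof.
rewrite subrKA [a - b - e]addrAC -[b - c - k]addrA subrKA.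
by rewrite opprD !addrA [a - e - c]addrAC.
Qed.

Lemma continuous_shift0 (R : realType) (V W : normedModType R) (G : V -> W)
    (x : V) :
  {for x, continuous G} -> G (h + x) @[h --> 0] --> G x.
Proof.
move=> cG.
have sx : h + x @[h --> 0] --> x.
  have : h + x @[h --> 0] --> 0 + x.
    by apply: cvgD; [exact: cvg_id|exact: cvg_cst].
  by rewrite add0r.
exact: (cvg_comp _ _ sx cG).
Qed.

(** * Substitution in a C^1 function with values in C^1 *)

Section C1_comp.
Variables (R : realType) (d : nat).
Variable F : 'rV[R]_d -> 'rV[R]_d -> 'rV[R]_d.
Hypothesis hF : C1_C1_per F.

Let Df x h := fun xi : 'rV[R]_d => 'd (F^~ xi) x h.

Lemma Df_sum x h :
  Df x h = \sum_i (h ord0 i *: Df x (delta_mx ord0 i)).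
Proof.
apply/funext => xi; rewrite fct_sumE /=.
exact: (linear_rV_delta ('d (F^~ xi) x)).
Qed.

(** Joint continuity of (x, xi) |-> 'D_k (F x) xi. It is read off from the
    differentiability of x |-> F x in the Frechet topology: that topology also
    controls the xi-derivatives of the difference quotient Q h, and
    F (x + h) = F x + Df x h + |h| Q h can be differentiated in xi term by
    term, Df x h being a combination of the d functions Df x e_i with
    coefficients tending to 0. *)
Lemma derive_snd_cvg (T : Type) (Phi : set_system T) {FPhi : Filter Phi}
    (y xi : T -> 'rV[R]_d) (x k xi0 : 'rV[R]_d) :
  y t @[t --> Phi] --> x -> xi t @[t --> Phi] --> xi0 ->
  'D_k (F (y t)) (xi t) @[t --> Phi] --> 'D_k (F x) xi0.
Proof.
move=> cy cxi; have [_ F1 _ D1 [FQ _]] := hF.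
have [_ /(_ k) QD] := FQ x.
pose Q (h xi : 'rV[R]_d) := `|h|^-1 *: (F (x + h) xi - F x xi - Df x h xi).
have D0 : 'D_k (cst (0 : 'rV[R]_d)) = cst (0 : 'rV[R]_d).
  by apply/funext => xi'; rewrite derive_cst.
have {}QD : {family compact, 'D_k (Q h) @[h --> (0 : 'rV[R]_d)] -->
    cst (0 : 'rV[R]_d)}.
  by rewrite -[X in {family compact, _ --> X}]D0; exact: QD.
have dQ (h xi' : 'rV[R]_d) : derivable (Q h) xi' k.
  rewrite -[Q h]/(`|h|^-1 \*: (F (x + h) - F x - Df x h)).
  by apply/derivableZ/derivableB; [apply/derivableB|]; apply/diff_derivable;
    [exact: (F1 _).1|exact: (F1 _).1|exact: (D1 _ _).1].
have FE h : F (x + h) = F x +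
    \sum_(i < d) (h ord0 i \*: Df x (delta_mx ord0 i)) + `|h| \*: Q h.
  apply/funext => xi'; rewrite !fctE fct_sumE.
  have := congr1 (@^~ xi') (Df_sum x h); rewrite fct_sumE /= => <-.
  rewrite /Q; have [->|h0] := eqVneq h 0.
    rewrite addr0 normr0 scale0r addr0.
    rewrite [Df _ _ _](_ : _ = 0) ?addr0 //.
    exact: (linear0 ('d (F^~ xi') x)).
  rewrite scalerA mulfV ?normr_eq0// scale1r -[X in _ = _ + X]addrA -opprD.
  by rewrite [RHS]addrC subrK.
have DE (h xi' : 'rV[R]_d) : 'D_k (F (x + h)) xi' = 'D_k (F x) xi' +
    \sum_i h ord0 i *: 'D_k (Df x (delta_mx ord0 i)) xi' +
    `|h| *: 'D_k (Q h) xi'.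
  have dD i : is_derive xi' k (h ord0 i \*: Df x (delta_mx ord0 i))
      (h ord0 i *: 'D_k (Df x (delta_mx ord0 i)) xi').
    by apply/is_deriveZ/derivableP/diff_derivable; exact: (D1 _ _).1.
  have dF : is_derive xi' k (F x) ('D_k (F x) xi').
    by apply/derivableP/diff_derivable; exact: (F1 _).1.
  have dQh : is_derive xi' k (`|h| \*: Q h) (`|h| *: 'D_k (Q h) xi').
    exact/is_deriveZ/derivableP.
  have dS := is_deriveD (is_deriveD dF (is_derive_sum dD)) dQh.
  by rewrite (FE h); exact: (@derive_val _ _ _ _ _ _ _ dS).
pose h t := y t - x.
have ch : h t @[t --> Phi] --> (0 : 'rV[R]_d) by apply/subr_cvg0.
have A : 'D_k (F x) (xi t) @[t --> Phi] --> 'D_k (F x) xi0.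
  exact: (continuous_cvg FPhi ((F1 x).2 k xi0) cxi).
have B := cvg_coord_scale0 (FPhi := FPhi) ch
  (fun i => continuous_cvg FPhi ((D1 x (delta_mx ord0 i)).2 k xi0) cxi).
have C : `|h t| *: 'D_k (Q (h t)) (xi t) @[t --> Phi] --> (0 : 'rV[R]_d).
  have QDh : {family compact, 'D_k (Q (h t)) @[t --> Phi] -->
      cst (0 : 'rV[R]_d)} by exact: (cvg_comp _ _ ch QD).
  have c0 : {for xi0, continuous (cst (0 : 'rV[R]_d))} by exact: cst_continuous.
  exact: (cvg_norm_scale0 ch (family_compact_cvg_diag QDh c0 cxi)).
rewrite (eq_cvg _ _ (fun t => congr1 (fun z => 'D_k (F z) (xi t))
  (esym (subrKC x (y t))))) (eq_cvg _ _ (fun t => DE (h t) (xi t))).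
exact: (cvg_add0 A B C).
Qed.

(** The increment of x |-> F x (G x) is split into a change of the first
    argument of F with the second one frozen at the moving point G (h + x)
    (limit A), the replacement of G (h + x) by G x inside the partial
    differential (limit C), and the increment of the composition F x o G
    (limit B). *)
Lemma differentiable_diag (G : 'rV[R]_d -> 'rV[R]_d) x : C1 G ->
  differentiable (fun x => F x (G x)) x /\
  'd (fun x => F x (G x)) x =
    (fun h => 'd (F^~ (G x)) x h + 'd (F x) (G x) ('d G x h)) :> (_ -> _).
Proof.
move=> G1; have [_ F1 F2 D1 [FQ _]] := hF.
have cG := continuous_shift0 (C1_continuous G1 (x := x)).
have dFG : differentiable (F x \o G) x.
  by apply: differentiable_comp; [exact: G1.1|exact: (F1 x).1].
have -> : (fun h => 'd (F^~ (G x)) x h + 'd (F x) (G x) ('d G x h)) =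
    'd (F^~ (G x)) x \+ 'd (F x \o G) x.
  have E := diff_comp (G1.1 x) ((F1 x).1 (G x)).
  apply/funext => h.
  exact: (congr1 (fun L => 'd (F^~ (G x)) x h + L h) (esym E)).
apply: diff_from_quotient.
  exact: (continuous_addmap (diff_continuous (F2 x (G x)))
    (diff_continuous dFG)).
have A : `|h|^-1 *: (F (x + h) (G (h + x)) - F x (G (h + x)) -
    Df x h (G (h + x))) @[h --> 0] --> (0 : 'rV[R]_d).
  have c0 : {for G x, continuous (cst (0 : 'rV[R]_d))} by exact: cst_continuous.
  exact: (family_compact_cvg_diag (FQ x).1 c0 cG).
have B := diff_quotient_cvg0 dFG.
have C : `|h|^-1 *: (Df x h (G (h + x)) - Df x h (G x))
    @[h --> 0] --> (0 : 'rV[R]_d).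
  have C0 : \sum_j `|Df x (delta_mx ord0 j) (G (h + x)) -
       Df x (delta_mx ord0 j) (G x)| @[h --> 0] --> (0 : R).
    exact: (cvg_sum_dist (fun j => cvg_comp _ _ cG
      (C1_continuous (D1 x (delta_mx ord0 j)) (x := G x)))).
  (* By linearity in h, the variation of Df x h is at most |h| times the sum
     of the variations of the d partial derivatives. *)
  refine (quotient_cvg0 _ C0) => h.
  exact: (norm_linear_rV_le ('d (F^~ (G (h + x))) x \- 'd (F^~ (G x)) x) h).
have E h : `|h|^-1 *: (F (h + x) (G (h + x)) - F x (G x) -
      ('d (F^~ (G x)) x \+ 'd (F x \o G) x) h) =
    `|h|^-1 *: (F (x + h) (G (h + x)) - F x (G (h + x)) -
      Df x h (G (h + x))) +
    `|h|^-1 *: (Df x h (G (h + x)) - Df x h (G x)) +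
    `|h|^-1 *: ((F x \o G) (h + x) - (F x \o G) x - 'd (F x \o G) x h).
  rewrite -!scalerDr [x + h]addrC; congr (_ *: _).
  exact: split_increment.
rewrite (eq_cvg _ _ E).
exact: (cvg_add0 A C B).
Qed.

Lemma C1_diag (G : 'rV[R]_d -> 'rV[R]_d) : C1 G -> C1 (fun x => F x (G x)).
Proof.
move=> G1; split=> [x|k x]; first exact: (differentiable_diag x G1).1.
have [_ F1 F2 D1 [FQ FD]] := hF.
have DE y : 'D_k (fun x => F x (G x)) y = Df y k (G y) +
    \sum_i ('D_k G y) ord0 i *: 'D_(delta_mx ord0 i) (F y) (G y).
  have [dFG dE] := differentiable_diag y G1.
  rewrite deriveE// dE; congr (_ + _).
  rewrite linear_rV_delta deriveE; last exact: G1.1.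
  by apply: eq_bigr => i _; rewrite deriveE//; exact: (F1 y).1.
rewrite (_ : 'D_k _ = fun y => Df y k (G y) +
    \sum_i ('D_k G y) ord0 i *: 'D_(delta_mx ord0 i) (F y) (G y)); last first.
  exact/funext.
have cG : {for x, continuous G} := C1_continuous G1 (x := x).
have A := family_compact_cvg_diag (FPhi := nbhs_filter x) (FD k x).1
  (C1_continuous (D1 x k) (x := G x)) cG.
have B (i : 'I_d) := derive_snd_cvg (k := delta_mx ord0 i)
  (FPhi := nbhs_filter x) cvg_id cG.
have C := cvg_coord_scale (FPhi := nbhs_filter x) (G1.2 k x) B.
exact: (cvgD (FF := nbhs_filter x) A C).
Qed.

End C1_comp.

(** * Calculus along curves and periodic functions *)

Lemma is_derive_comp_curve (R : realType) (V W : normedModType R) (f : V -> W)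
    (X : R -> V) (t : R) (w : V) :
  is_derive t (1 : R) X w -> differentiable f (X t) ->
  is_derive t (1 : R) (f \o X) ('d f (X t) w).
Proof.
move=> dX df.
have dXt : differentiable X t by apply/derivable1_diffP; exact: ex_derive.
have dfX : differentiable (f \o X) t by exact: differentiable_comp.
apply: DeriveDef; first exact: diff_derivable.
have E : 'd X t 1 = w by rewrite -deriveE// derive_val.
by rewrite deriveE// diff_comp//= E.
Qed.

Lemma is_derive_line (R : realType) (V W : normedModType R) (f : V -> W)
    (x h : V) (t : R) :
  differentiable f (x + t *: h) ->
  is_derive t (1 : R) (fun s => f (x + s *: h)) ('D_h f (x + t *: h)).
Proof.
move=> df.
have ds : is_derive t (1 : R) ( *:%R^~ h) h.
  apply: DeriveDef; first exact/derivable1_diffP.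
  by rewrite deriveE// diff_val scale1r.
have dl : is_derive t (1 : R) (fun s : R => x + s *: h) h.
  rewrite -[X in is_derive _ _ _ X]add0r.
  exact: (is_deriveD (is_derive_cst x t 1) ds).
rewrite deriveE//.
exact: (is_derive_comp_curve dl df).
Qed.

Lemma is_derive_coord (R : realType) (d : nat) (X : R -> 'rV[R]_d) (t : R)
    (w : 'rV[R]_d) (i : 'I_d) :
  is_derive t (1 : R) X w ->
  is_derive t (1 : R) (fun s => X s ord0 i) (w ord0 i).
Proof.
move=> dX; have dXt := @ex_derive _ _ _ _ _ _ _ dX.
apply: DeriveDef; first exact: ((derivable_mxP X t 1).1 dXt).
by have := @derive_val _ _ _ _ _ _ _ dX; rewrite derive_mx// => <-; rewrite mxE.
Qed.

Lemma derive_periodic (R : realType) (d : nat) (W : normedModType R)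
    (f : 'rV[R]_d -> W) h : periodic_rV f -> periodic_rV ('D_h f).
Proof.
move=> pf x k; rewrite /derive.
have -> : (fun s : R => s^-1 *: ((f \o shift (x + map_mx intr k)) (s *: h) -
    f (x + map_mx intr k))) =
    (fun s => s^-1 *: ((f \o shift x) (s *: h) - f x)); last by [].
by apply/funext => s /=; rewrite addrA !pf.
Qed.

Lemma unit_cube_translate (R : realType) (d : nat) (x : 'rV[R]_d) :
  exists k : 'rV[int]_d, unit_cube (x + map_mx intr k).
Proof.
exists (\row_i (- Num.floor (x ord0 i))) => i.
rewrite !mxE intrN subr_ge0 Num.Theory.ge_floor /= ltrBlDr addrC.
by rewrite -[X in _ < _ + X]/(1%:~R) -intrD Num.Theory.lt_succ_floor.
Qed.

Definition closed_unit_cube (R : realType) (d : nat) : set 'rV[R]_d :=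
  [set x | forall i, `[0, 1]%classic (x ord0 i)].

Lemma closed_unit_cube_compact (R : realType) (d : nat) :
  compact (@closed_unit_cube R d).
Proof.
apply: (@rV_compact R d (fun=> `[0, 1]%classic)) => _.
exact: segment_compact.
Qed.

Lemma unit_cube_sub_closed (R : realType) (d : nat) :
  @unit_cube R d `<=` @closed_unit_cube R d.
Proof.
by move=> x xc i; have /andP[x0 x1] := xc i; rewrite /= in_itv/= x0 ltW.
Qed.

Lemma periodic_bounded (R : realType) (d : nat) (W : normedModType R)
    (f : 'rV[R]_d -> W) : continuous f -> periodic_rV f ->
  exists2 M, 0 <= M & forall x, `|f x| <= M.
Proof.
move=> cf pf.
have /compact_bounded[M [Mr HM]] : compact (f @` @closed_unit_cube R d).
  apply: continuous_compact; last exact: closed_unit_cube_compact.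
  exact: continuous_subspaceT.
exists (`|M| + 1) => [|x]; first by rewrite addr_ge0.
have [k xk] := unit_cube_translate x; rewrite -(pf x k).
apply: HM; first by rewrite (le_lt_trans (ler_norm M))// ltrDl.
by exists (x + map_mx intr k) => //; exact: unit_cube_sub_closed.
Qed.

(** A maximum over the closed cube is a maximum over R^d by periodicity; it is
    translated back into the half-open fundamental domain. *)
Lemma periodic_max (R : realType) (d : nat) (f : 'rV[R]_d -> R) :
  continuous f -> periodic_rV f ->
  exists2 x0, unit_cube x0 & forall x, f x <= f x0.
Proof.
move=> cf pf.
have c0 : @closed_unit_cube R d !=set0.
  by exists 0 => i; rewrite /= mxE in_itv/= lexx ler01.
have [|c _ cmax] := EVT_max_rV c0 (@closed_unit_cube_compact R d) (f := f).
  exact: continuous_subspaceT.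
have [k ck] := unit_cube_translate c.
exists (c + map_mx intr k) => // x; rewrite pf.
have [l xl] := unit_cube_translate x; rewrite -(pf x l).
by apply: cmax; rewrite inE; exact: unit_cube_sub_closed.
Qed.

Lemma norm_rV_le (R : realType) (d : nat) (x : 'rV[R]_d) (e : R) : 0 <= e ->
  (forall i, `|x ord0 i| <= e) -> `|x| <= e.
Proof.
move=> e0 xe; rewrite [leLHS]/Num.norm /= mx_normrE.
by apply: bigmax_le => // -[i j] _ /=; rewrite (ord1 i).
Qed.

Lemma MVT_line (R : realType) (V : normedModType R) (f : V -> R) x y :
  (forall z, differentiable f z) -> exists c, f x - f y = 'D_(x - y) f c.
Proof.
move=> df; pose g (t : R) := f (y + t *: (x - y)).
have dg t : is_derive t (1 : R) g ('D_(x - y) f (y + t *: (x - y))).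
  exact: is_derive_line.
have [|t _] := MVT (ltr01 : (0 : R) < 1) (fun t _ => dg t).
  apply: continuous_subspaceT => t.
  by apply/differentiable_continuous/derivable1_diffP; exact: ex_derive.
rewrite subr0 mulr1 /g scale1r scale0r addr0 subrKC => E.
by exists (y + t *: (x - y)).
Qed.

(** The partial derivatives are periodic and continuous, hence bounded, and the
    mean value theorem along segments, applied to each coordinate, turns these
    bounds into a Lipschitz constant. *)
Lemma C1_per_lipschitz (R : realType) (d m : nat) (f : 'rV[R]_d -> 'rV[R]_m) :
  C1_per f -> exists2 L, 0 <= L & forall x y, `|f x - f y| <= L * `|x - y|.
Proof.
move=> [[df cf] pf].
have bD i : exists M, 0 <= M /\ forall x, `|'D_(delta_mx ord0 i) f x| <= M.
  have [M M0 HM] := periodic_bounded (cf (delta_mx ord0 i))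
    (derive_periodic (delta_mx ord0 i) pf).
  by exists M.
have [M HM] := choice bD.
have M0 : 0 <= \sum_i M i by apply: sumr_ge0 => i _; case: (HM i).
exists (\sum_i M i) => // x y.
apply: norm_rV_le => [|i]; first by rewrite mulr_ge0.
have di z : differentiable (fun y => f y ord0 i) z.
  exact: (@differentiable_comp _ _ _ _ f (fun N => N ord0 i) z (df z)
    (differentiable_coord _ _ _)).
have [c E] := MVT_line x y di.
have -> : (f x - f y) ord0 i = 'D_(x - y) f c ord0 i.
  rewrite !mxE E derive_mx; first by rewrite mxE.
  exact: diff_derivable.
rewrite (le_trans (coord_le_norm _ _))// deriveE//.
rewrite (le_trans (norm_linear_rV_le _ _))// mulrC ler_wpM2r//.
by apply: ler_sum => j _; rewrite -deriveE//; case: (HM j).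
Qed.

(** * Gronwall's inequality *)

Section gronwall.
Variables (R : realType) (g dg : R -> R) (C : R).
Hypothesis gD : forall t, is_derive t (1 : R) g (dg t).

(** The function g s * exp (- C s) is nonincreasing. *)
Lemma gronwall_forward : (forall t, dg t <= C * g t) ->
  forall t, 0 <= t -> g t <= g 0 * expR (C * t).
Proof.
move=> gC t t0.
pose k s := g s * expR (- C * s).
have dk s : is_derive s (1 : R) k ((dg s - C * g s) * expR (- C * s)).
  have de : is_derive s (1 : R) (fun s => expR (- C * s))
      (- C * expR (- C * s)).
    have dm : is_derive s (1 : R) ( *%R (- C)) (- C).
      have := @is_deriveZ _ _ _ id (- C) s (1 : R) (1 : R)
        (is_derive_id s (1 : R)).
      by rewrite /GRing.scale /= mulr1.
    by have := is_derive1_comp (is_derive_expR (- C * s)) dm; rewrite mulrC.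
  apply: (is_derive_eq (is_deriveM (gD s) de)).
  by rewrite /GRing.scale /=; ring.
have : k t <= k 0.
  have kN s : is_derive s (1 : R) (- k) (- ((dg s - C * g s) * expR (- C * s))).
    exact: is_deriveN.
  rewrite -lerN2 -[- k 0]/((- k) 0) -[- k t]/((- k) t).
  apply: (@ger0_derive1_ndecr _ (- k) 0 t) => //.
  - move=> s _; rewrite derive1E (@derive_val _ _ _ _ _ _ _ (kN s)) oppr_ge0.
    by rewrite mulr_le0_ge0 ?subr_le0 ?expR_ge0.
  - apply: continuous_subspaceT => s.
    apply/differentiable_continuous/derivable1_diffP.
    exact: (@ex_derive _ _ _ _ _ _ _ (kN s)).
rewrite /k mulr0 expR0 mulr1 mulNr expRN.
by rewrite ler_pdivrMr ?expR_gt0.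
Qed.

End gronwall.

Lemma gronwall_abs (R : realType) (g dg : R -> R) (C : R) :
  (forall t, is_derive t (1 : R) g (dg t)) -> (forall t, `|dg t| <= C * g t) ->
  forall t, g t <= g 0 * expR (C * `|t|).
Proof.
move=> gD gC t; have [t0|t0] := leP 0 t.
  rewrite ger0_norm//; apply: (gronwall_forward gD) => // s.
  exact: (le_trans (ler_norm _)).
rewrite ltr0_norm//.
have gND s : is_derive s (1 : R) (fun s => g (- s)) (- dg (- s)).
  have dN := is_deriveN (is_derive_id s (1 : R)).
  by have := is_derive1_comp (gD (- s)) dN; rewrite mulrN1.
have := gronwall_forward gND (C := C) _ (t := - t).
rewrite oppr0 opprK oppr_ge0; apply => //; last exact: ltW.
by move=> s; rewrite (le_trans _ (gC _))// -normrN ler_norm.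
Qed.

Lemma dot_norm_le (R : realType) (d : nat) (u w : 'rV[R]_d) :
  `|dot u w| <= d%:R * (`|u| * `|w|).
Proof.
rewrite /dot (le_trans (ler_norm_sum _ _ _))//.
rewrite [leRHS](_ : _ = \sum_(i < d) `|u| * `|w|).
  by apply: ler_sum => i _; rewrite normrM ler_pM// coord_le_norm.
by rewrite sumr_const card_ord mulr_natl.
Qed.

(** The norm of a row vector is the sup norm, which is not differentiable:
    Gronwall's argument is run on the Euclidean square [dot u u], compared here
    and in [dot_norm_le] with the square of the sup norm. *)
Lemma norm_sqr_le_dot (R : realType) (d : nat) (u : 'rV[R]_d) :
  `|u| ^+ 2 <= dot u u.
Proof.
have d0 : 0 <= dot u u.
  by apply: sumr_ge0 => i _; rewrite -expr2 sqr_ge0.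
rewrite -[leRHS]sqr_sqrtr// lerXn2r ?nnegrE ?sqrtr_ge0//.
apply: norm_rV_le; first exact: sqrtr_ge0.
move=> i; rewrite -sqrtr_sqr ler_wsqrtr//.
rewrite /dot (bigD1 i)//= expr2 lerDl.
by apply: sumr_ge0 => j _; rewrite -expr2 sqr_ge0.
Qed.

Lemma is_derive_dot_sqr (R : realType) (d : nat) (X : R -> 'rV[R]_d) t w :
  is_derive t (1 : R) X w ->
  is_derive t (1 : R) (fun s => dot (X s) (X s)) (2 * dot (X t) w).
Proof.
move=> dX.
have di i : is_derive t (1 : R) ((fun s => X s ord0 i) * (fun s => X s ord0 i))
    (2 * (X t ord0 i * w ord0 i)).
  have dXi := is_derive_coord i dX.
  apply: (is_derive_eq (is_deriveM dXi dXi)).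
  by rewrite /GRing.scale /= mulr_natl mulr2n.
have := is_derive_sum di.
rewrite -mulr_sumr (_ : \sum_(i < d) _ = fun s => dot (X s) (X s))//.
by apply/funext => s; rewrite fct_sumE.
Qed.

(** Gronwall's inequality for the squared Euclidean distance of two solutions.
    It serves twice: for two trajectories of a flow it gives the continuous
    dependence on the initial point, and against a constant solution it gives
    the uniqueness of solutions issued from a zero of b. *)
Lemma solution_dist (R : realType) (d : nat) (b : 'rV[R]_d -> 'rV[R]_d)
    (L : R) :
  0 <= L -> (forall x y, `|b x - b y| <= L * `|x - y|) ->
  exists2 C, 0 <= C & forall X Y : R -> 'rV[R]_d,
    (forall t, is_derive t (1 : R) X (b (X t))) ->
    (forall t, is_derive t (1 : R) Y (b (Y t))) ->
    forall t, `|X t - Y t| ^+ 2 <=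
      dot (X 0 - Y 0) (X 0 - Y 0) * expR (C * `|t|).
Proof.
move=> L0 bL; exists (2 * (d%:R * L)).
  by rewrite !mulr_ge0.
move=> X Y dX dY t; rewrite (le_trans (norm_sqr_le_dot _))//.
have dXY s : is_derive s (1 : R) (X - Y) (b (X s) - b (Y s)).
  exact: is_deriveB.
apply: (gronwall_abs (g := fun s => dot ((X - Y) s) ((X - Y) s))
  (fun s => is_derive_dot_sqr (dXY s))) => s.
rewrite normrM ger0_norm// -mulrA ler_wpM2l//.
rewrite (le_trans (dot_norm_le _ _))// -mulrA ler_wpM2l//.
apply: (@le_trans _ _ (L * `|X s - Y s| ^+ 2)).
  by rewrite expr2 mulrCA ler_wpM2l// bL.
by rewrite ler_wpM2l// norm_sqr_le_dot.
Qed.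

(** * Integration over the unit cube *)

Lemma continuous_measurable_rV (R : realType) (d : nat) (f : 'rV[R]_d -> R) :
  continuous f -> measurable_fun setT (f : borel_rV R d -> R).
Proof.
move=> cf; apply: (measurability _ (RGenOpens.measurableE R)) => //.
move=> _ [_ [a [b ->] <-]]; rewrite setTI; apply: open_measurable_rV.
by apply: open_comp => [x _|]; [exact: cf|exact: interval_open].
Qed.

Lemma unit_cubeE (R : realType) (d : nat) : @unit_cube R d =
  [set x : 'rV[R]_d | forall i, `[0, 1[%classic (x ord0 i)].
Proof.
by apply/seteqP; split => x xc i; have := xc i; rewrite /= in_itv.
Qed.

Lemma measurable_unit_cube (R : realType) (d : nat) :
  measurable (@unit_cube R d : set (borel_rV R d)).
Proof.
by rewrite unit_cubeE; apply: (@measurable_box_rV R d (fun=> `[0, 1[%classic)).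
Qed.

Lemma lebesgue_unit_cube (R : realType) (d : nat) :
  lebesgue_rV (@unit_cube R d) = 1%E.
Proof.
rewrite unit_cubeE (@lebesgue_rV_box R d (fun=> `[0, 1[%classic))//.
rewrite big1// => i _.
by rewrite lebesgue_measure_itv/= lte_fin ltr01 oppr0 adde0.
Qed.

Lemma integrable_unit_cube (R : realType) (d : nat)
    (mu : {measure set (borel_rV R d) -> \bar R}) (f : 'rV[R]_d -> R) (M : R) :
  (mu (@unit_cube R d) < +oo)%E -> continuous f -> (forall x, `|f x| <= M) ->
  mu.-integrable (@unit_cube R d) (EFin \o f).
Proof.
move=> fC cf HM; apply: measurable_bounded_integrable => //.
- exact: measurable_unit_cube.
- by apply: measurable_funTS; exact: continuous_measurable_rV.
- exists M; split; [exact: num_real|] => N MN x _.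
  exact: (le_trans (HM x) (ltW MN)).
Qed.

Definition set_coord (R : realType) (d : nat) (x : 'rV[R]_d) (i : 'I_d)
    (t : R) : 'rV[R]_d :=
  \row_j (if j == i then t else x ord0 j).

Lemma set_coordE (R : realType) (d : nat) (x : 'rV[R]_d) i t :
  set_coord x i t = set_coord x i 0 + t *: delta_mx ord0 i.
Proof.
apply/rowP => j; rewrite !mxE eqxx /=; case: eqP => _.
  by rewrite mulr1 add0r.
by rewrite mulr0 addr0.
Qed.

Lemma cons_rV0 (R : realType) (d : nat) (p : R * borel_rV R d) :
  (cons_rV p : 'rV[R]_d.+1) ord0 ord0 = p.1.
Proof.
have := @row_mxEl _ _ 1 d (p.1%:M : 'M[R]_1) (p.2 : 'rV[R]_d) ord0 ord0.
rewrite [in RHS]mxE eqxx mulr1n => <-; congr (row_mx _ _ _ _).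
exact/val_inj.
Qed.

Lemma cons_rVS (R : realType) (d : nat) (p : R * borel_rV R d) j :
  (cons_rV p : 'rV[R]_d.+1) ord0 (lift ord0 j) = (p.2 : 'rV[R]_d) ord0 j.
Proof.
have <- := @row_mxEr _ _ 1 d (p.1%:M : 'M[R]_1) (p.2 : 'rV[R]_d) ord0 j.
by congr (row_mx _ _ _ _); exact/val_inj.
Qed.

Lemma set_coord_cons0 (R : realType) (d : nat) (s t : R) (y : 'rV[R]_d) :
  set_coord (cons_rV (s, y : borel_rV R d)) ord0 t =
  cons_rV (t, y : borel_rV R d).
Proof.
apply/rowP => k; rewrite mxE.
have [j ->|->] := unliftP ord0 k; last by rewrite eqxx cons_rV0.
by rewrite eq_sym (negbTE (neq_lift _ _)) !cons_rVS.
Qed.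

Lemma set_coord_consS (R : realType) (d : nat) (s t : R) (y : 'rV[R]_d) i :
  set_coord (cons_rV (s, y : borel_rV R d)) (lift ord0 i) t =
  cons_rV (s, set_coord y i t : borel_rV R d).
Proof.
apply/rowP => k; rewrite mxE.
have [j ->|->] := unliftP ord0 k; last first.
  by rewrite (negbTE (neq_lift _ _)) !cons_rV0.
by rewrite !cons_rVS mxE (inj_eq lift_inj).
Qed.

(** Tonelli's theorem for a measure that is transported from a product, over a
    set that is a rectangle in the product. This is the form of the Lebesgue
    measure of R^(d+1), transported from R x R^d by [cons_rV]. *)
Section pushforward_fubini.
Context d1 d2 d3 (T1 : measurableType d1) (T2 : measurableType d2)
  (T3 : measurableType d3) (R : realType).
Variables (m1 : {sigma_finite_measure set T1 -> \bar R})
  (m2 : {sigma_finite_measure set T2 -> \bar R}) (phi : T1 * T2 -> T3)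
  (g : T3 -> \bar R) (A : set T1) (B : set T2) (D : set T3).
Hypotheses (mA : measurable A) (mB : measurable B) (mD : measurable D).
Hypotheses (mphi : measurable_fun setT phi) (mg : measurable_fun setT g).
Hypotheses (g0 : forall x, (0 <= g x)%E) (phiD : phi @^-1` D = A `*` B).

Let f := (g \o phi) \_ (A `*` B).

Let mf : measurable_fun setT f.
Proof.
have mgp := measurable_funS measurableT (@subsetT _ (setT `&` (A `*` B)))
  (measurableT_comp mg mphi).
exact: (measurable_restrict _ (measurableX mA mB) measurableT).1 mgp.
Qed.

Let f0 p : (0 <= f p)%E.
Proof. by rewrite /f patchE; case: ifP => // _; exact: g0. Qed.

Let pushforwardE : (\int[pushforward (m1 \x m2) phi]_(x in D) g x =
  \int[m1 \x m2]_p f p)%E.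
Proof.
rewrite (ge0_integral_pushforward mphi)//; last exact: measurable_funS mg.
by rewrite phiD integral_mkcond.
Qed.

Lemma pushforward_fubini1 : (\int[pushforward (m1 \x m2) phi]_(x in D) g x =
  \int[m1]_(t in A) \int[m2]_(y in B) g (phi (t, y)))%E.
Proof.
rewrite pushforwardE (fubini_tonelli1 f mf f0) [RHS]integral_mkcond.
apply: eq_integral => t _; rewrite /fubini_F patchE; case: ifPn => tA.
  rewrite [RHS]integral_mkcond; apply: eq_integral => y _.
  by rewrite /f !patchE in_setX tA.
by apply: integral0_eq => y _; rewrite /f patchE in_setX (negbTE tA).
Qed.

Lemma pushforward_fubini2 : (\int[pushforward (m1 \x m2) phi]_(x in D) g x =
  \int[m2]_(y in B) \int[m1]_(t in A) g (phi (t, y)))%E.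
Proof.
rewrite pushforwardE (fubini_tonelli2 f mf f0) [RHS]integral_mkcond.
apply: eq_integral => y _; rewrite /fubini_G patchE; case: ifPn => yB.
  rewrite [RHS]integral_mkcond; apply: eq_integral => t _.
  by rewrite /f !patchE in_setX yB andbT.
by apply: integral0_eq => t _; rewrite /f patchE in_setX (negbTE yB) andbF.
Qed.

End pushforward_fubini.

Lemma preimage_cons_unit_cube (R : realType) (d : nat) :
  @cons_rV R d @^-1` @unit_cube R d.+1 = `[0, 1[%classic `*` @unit_cube R d.
Proof.
by rewrite !unit_cubeE (@preimage_cons_rV_box R d (fun=> `[0, 1[%classic)).
Qed.

Lemma integral_cube_consl (R : realType) (d : nat)
    (g : borel_rV R d.+1 -> \bar R) :
  measurable_fun setT g -> (forall x, 0 <= g x)%E ->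
  (\int[@lebesgue_rV R d.+1]_(x in @unit_cube R d.+1) g x =
  \int[lebesgue_measure]_(t in `[0%R, 1%R[)
   \int[@lebesgue_rV R d]_(y in @unit_cube R d) g (cons_rV (t, y)))%E.
Proof.
move=> mg g0.
exact: (pushforward_fubini1 lebesgue_measure (@lebesgue_rV R d)
  (measurable_itv _) (@measurable_unit_cube R d) (@measurable_unit_cube R d.+1)
  (@measurable_cons_rV R d) mg g0 (@preimage_cons_unit_cube R d)).
Qed.

Lemma integral_cube_consr (R : realType) (d : nat)
    (g : borel_rV R d.+1 -> \bar R) :
  measurable_fun setT g -> (forall x, 0 <= g x)%E ->
  (\int[@lebesgue_rV R d.+1]_(x in @unit_cube R d.+1) g x =
  \int[@lebesgue_rV R d]_(y in @unit_cube R d)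
   \int[lebesgue_measure]_(t in `[0%R, 1%R[) g (cons_rV (t, y)))%E.
Proof.
move=> mg g0.
exact: (pushforward_fubini2 lebesgue_measure (@lebesgue_rV R d)
  (measurable_itv _) (@measurable_unit_cube R d) (@measurable_unit_cube R d.+1)
  (@measurable_cons_rV R d) mg g0 (@preimage_cons_unit_cube R d)).
Qed.

(** If g has the same integral over all unit segments parallel to e_i, this
    common value is its integral over the cube. In the induction on d, the
    segments along the first coordinate are integrated first, and for any other
    coordinate the first one is frozen and the induction hypothesis applies. *)
Lemma integral_cube_lines (R : realType) (d : nat) (i : 'I_d)
    (g : borel_rV R d -> \bar R) (c : \bar R) :
  measurable_fun setT g -> (forall x, 0 <= g x)%E ->
  (forall x : 'rV[R]_d,
    \int[lebesgue_measure]_(t in `[0%R, 1%R[) g (set_coord x i t) = c)%E ->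
  (\int[@lebesgue_rV R d]_(x in @unit_cube R d) g x = c)%E.
Proof.
elim: d i g => [[]//|d IH] i g mg g0 gc.
have [j ij|i0] := unliftP ord0 i.
  rewrite integral_cube_consl//.
  under eq_integral => t _.
    rewrite (IH j (fun y => g (cons_rV (t, y)))) //; last first.
    - move=> x; rewrite -(gc (cons_rV (t, x : borel_rV R d))) ij.
      by apply: eq_integral => s _; rewrite set_coord_consS.
    - apply: (measurableT_comp mg).
      apply: (measurableT_comp (@measurable_cons_rV R d)).
      exact: measurable_pair1.
  over.
  rewrite integral_cst//= lebesgue_measure_itv/= lte_fin ltr01 oppr0 adde0.
  by rewrite mule1.
rewrite integral_cube_consr//.
under eq_integral => y _.
  rewrite (_ : integral _ _ _ = c); last first.
    rewrite -(gc (cons_rV (0, y))) i0.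
    by apply: eq_integral => s _; rewrite set_coord_cons0.
over.
rewrite integral_cst; last exact: measurable_unit_cube.
transitivity (c * lebesgue_rV (@unit_cube R d))%E; first by [].
by rewrite lebesgue_unit_cube mule1.
Qed.

(** * Periodicity of the corrector *)

(** The constant M makes room for nonnegative integrands, as required by
    Tonelli's theorem. *)
Lemma integral_line_derivative (R : realType) (d : nat) (v : 'rV[R]_d -> R)
    (i : 'I_d) (x : 'rV[R]_d) (M : R) : C1 v ->
  (\int[lebesgue_measure]_(t in `[0%R, 1%R[)
    ('D_(delta_mx ord0 i) v (x + t *: delta_mx ord0 i) + M)%:E =
  (v (x + delta_mx ord0 i) - v x + M)%:E)%E.
Proof.
move=> [dv cv].
pose e : 'rV[R]_d := delta_mx ord0 i.
pose f t : R := 'D_e v (x + t *: e) + M.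
pose F t : R := v (x + t *: e) + M * t.
have dF t : is_derive t (1 : R) F (f t).
  have dm : is_derive t (1 : R) ( *%R M) M.
    have := @is_deriveZ _ _ _ id M t (1 : R) (1 : R) (is_derive_id t (1 : R)).
    by rewrite /GRing.scale /= mulr1.
  exact: (is_deriveD (is_derive_line (dv _)) dm).
have cF : continuous F.
  move=> t; apply/differentiable_continuous/derivable1_diffP; exact: ex_derive.
have cl : continuous (fun t : R => x + t *: e).
  move=> t; apply: cvgD; first exact: cvg_cst.
  exact: scalel_continuous.
have cf : continuous f.
  move=> t; apply: cvgD; last exact: cvg_cst.
  exact: (cvg_comp _ _ (cl t) (cv e (x + t *: e))).
rewrite integral_itv_bndo_bndc; last first.
  apply/measurable_EFinP; apply: measurable_funTS.
  exact: (continuous_measurable_fun cf).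
rewrite (continuous_FTC2 (F := F) ltr01).
- rewrite /F scale1r scale0r addr0 mulr1 mulr0 addr0 -EFinB.
  by congr EFin; ring.
- exact: continuous_subspaceT.
- split.
  + by move=> t _; exact: ex_derive.
  + exact/cvg_at_right_filter/cF.
  + exact/cvg_at_left_filter/cF.
- by move=> t _; rewrite derive1E derive_val.
Qed.

(** By the fundamental theorem of calculus the integral of the partial
    derivative over any unit segment parallel to e_i is the increment c, which
    does not depend on the segment. *)
Lemma mean_partial (R : realType) (d : nat) (v : 'rV[R]_d -> R)
    (i : 'I_d) (c : R) : C1 v -> periodic_rV ('D_(delta_mx ord0 i) v) ->
  (forall x, v (x + delta_mx ord0 i) - v x = c) ->
  \int[@lebesgue_rV R d]_(x in @unit_cube R d) 'D_(delta_mx ord0 i) v x = c.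
Proof.
move=> C1v pv vc; have [dv cv] := C1v.
set w := 'D_(delta_mx ord0 i) v.
have cw : continuous w := cv _.
have [M M0 HM] := periodic_bounded cw pv.
have mw := continuous_measurable_rV cw.
have mC := @measurable_unit_cube R d.
have fC : (@lebesgue_rV R d (@unit_cube R d) < +oo)%E.
  by rewrite lebesgue_unit_cube ltry.
have iw := integrable_unit_cube fC cw HM.
have iM := integrable_unit_cube (f := cst M) fC (@cst_continuous _ _ _)
  (fun=> lexx `|M|).
have key : \int[@lebesgue_rV R d]_(x in @unit_cube R d) (w x + M) = c + M.
  rewrite /Rintegral (integral_cube_lines (i := i) (c := (c + M)%:E))//.
  - by apply/measurable_EFinP; exact: measurable_funD.
  - move=> x; rewrite lee_fin -lerBlDr sub0r.
    by have := HM x; rewrite ler_norml => /andP[].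
  - move=> x; have := integral_line_derivative i (set_coord x i 0) M C1v.
    rewrite vc => <-; apply: eq_integral => t _.
    by rewrite -set_coordE.
move: key; rewrite RintegralD// Rintegral_cst//.
rewrite [fine _](_ : _ = 1) ?mulr1; first exact: addIr.
by rewrite -[RHS]/(fine (1 : \bar R)) -(lebesgue_unit_cube R d).
Qed.

(** The increment v (x + k) - v x has zero gradient, so it is constant along the
    segment from y to x. *)
Lemma translate_increment (R : realType) (d : nat) (v : 'rV[R]_d -> R)
    (k : 'rV[int]_d) : (forall x, differentiable v x) ->
  (forall h, periodic_rV ('D_h v)) ->
  forall x y, v (x + map_mx intr k) - v x = v (y + map_mx intr k) - v y.
Proof.
move=> dv pv x y; set a := map_mx intr k.
pose phi (s : R) := v ((y + a) + s *: (x - y)) - v (y + s *: (x - y)).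
have dphi s : is_derive s (1 : R) phi 0.
  have := is_deriveB (is_derive_line (dv ((y + a) + s *: (x - y))))
    (is_derive_line (dv (y + s *: (x - y)))).
  by rewrite [y + a + _]addrAC pv subrr.
have := is_derive_0_is_cst 1 0 dphi.
rewrite /phi !scale1r !scale0r !addr0 [y + a + _]addrAC subrKC => ->.
by [].
Qed.

Lemma periodic_of_basis (R : realType) (d : nat) (u : 'rV[R]_d -> R) :
  (forall i x, u (x + delta_mx ord0 i) = u x) -> periodic_rV u.
Proof.
move=> ue x k; move: x.
have -> : map_mx intr k = \sum_i (delta_mx ord0 i *~ k ord0 i) :> 'rV[R]_d.
  rewrite [LHS]row_sum_delta; apply: eq_bigr => i _.
  by rewrite mxE scaler_int.
elim/big_ind : _ => [x|a b ua ub x|i _].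
- by rewrite addr0.
- by rewrite addrA ub.
- elim: (k ord0 i) => [x|n IH x|n IH x].
  + by rewrite mulr0z addr0.
  + by rewrite intS mulrzDr mulr1z addrA IH ue.
  + rewrite -[RHS]IH -[LHS](ue i); congr u.
    rewrite -addrA; congr (x + _).
    by rewrite intS opprD mulrzDr mulrN1z addrC addNKr.
Qed.

Lemma gradE (R : realType) (d : nat) (v : 'rV[R]_d -> R) x h :
  differentiable v x -> 'D_h v x = dot (grad v x) h.
Proof.
move=> dv; rewrite deriveE// linear_rV_delta /dot; apply: eq_bigr => i _.
by rewrite -deriveE// mxE mulrC.
Qed.

(** The increment of v along e_i is constant, so it equals the mean of the i-th
    partial derivative; removing the linear function with slope the mean
    gradient cancels it. *)
Lemma corrector_periodic (R : realType) (d : nat) (v : 'rV[R]_d -> R) :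
  C1 v -> periodic_rV (grad v) ->
  periodic_rV (fun x => v x - dot (torus_mean (grad v)) x).
Proof.
move=> C1v pv.
have pD h : periodic_rV ('D_h v).
  by move=> x k; rewrite !gradE ?pv//; exact: C1v.1.
apply: periodic_of_basis => i x.
have ei : delta_mx ord0 i =
    map_mx intr (delta_mx ord0 i : 'rV[int]_d) :> 'rV[R]_d.
  by apply/rowP => j; rewrite !mxE; case: (_ && _).
have E : torus_mean (grad v) ord0 i = v (x + delta_mx ord0 i) - v x.
  rewrite mxE; transitivity
      (\int[@lebesgue_rV R d]_(y in @unit_cube R d) 'D_(delta_mx ord0 i) v y).
    by apply: eq_Rintegral => y _; rewrite mxE.
  apply: mean_partial => // y.
  by rewrite ei; apply: translate_increment => //; exact: C1v.1.
have -> : dot (torus_mean (grad v)) (x + delta_mx ord0 i) =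
    dot (torus_mean (grad v)) x + torus_mean (grad v) ord0 i.
  rewrite /dot [in RHS](_ : torus_mean (grad v) ord0 i = \sum_j
     torus_mean (grad v) ord0 j * (delta_mx ord0 i : 'rV[R]_d) ord0 j).
    rewrite -big_split; apply: eq_bigr => j _.
    by rewrite [(x + _) _ _]mxE mulrDr.
  rewrite (bigD1 i)//= big1 ?addr0.
    by rewrite [delta_mx _ _ _ _]mxE !eqxx mulr1.
  by move=> j ji; rewrite [delta_mx _ _ _ _]mxE eqxx (negbTE ji) mulr0.
by rewrite E; ring.
Qed.

(** * Rotation set of a field with a strict Lyapunov function *)

Lemma lipschitz_continuous (R : realType) (V W : normedModType R) (f : V -> W)
    (K : R) : 0 <= K -> (forall x y, `|f x - f y| <= K * `|x - y|) ->
  continuous f.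
Proof.
move=> K0 HK x; apply/cvgrPdist_lt => e e0.
have K1 : 0 < K + 1 by rewrite ltr_wpDl.
near=> y; rewrite (le_lt_trans (HK x y))//.
rewrite (@le_lt_trans _ _ ((K + 1) * `|x - y|))//.
  by rewrite ler_wpM2r// lerDl.
rewrite mulrC -ltr_pdivlMr//.
near: y; apply: (@cvgr_dist_lt _ _ _ (nbhs x) _ id x cvg_id).
by rewrite divr_gt0.
Unshelve. all: by end_near. Qed.

Lemma continuous_composition (U V W : topologicalType) (f : U -> V)
    (g : V -> W) :
  continuous f -> continuous g -> continuous (fun x => g (f x)).
Proof. by move=> cf cg x; exact: (continuous_comp (cf x) (cg (f x))). Qed.

Lemma zero_in_itvN11 (R : realType) : (0 : R) \in `]-1, 1[.
Proof. by rewrite in_itv/= ltrN10 ltr01. Qed.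

Lemma lerN1 (R : realType) : (-1 : R) <= 1.
Proof. exact: (le_trans (lerN10 _) ler01). Qed.

(** Only the sign of the derivative of u along b, and the case where it
    vanishes, enter the argument; F and v are used to produce u. *)
Section lyapunov.
Variables (R : realType) (d : nat) (b : 'rV[R]_d -> 'rV[R]_d).
Variables (X : R -> 'rV[R]_d -> 'rV[R]_d) (u : 'rV[R]_d -> R).
Hypotheses (b1 : C1_per b) (flowX : is_flow b X).
Hypotheses (du : forall x, differentiable u x) (pu : periodic_rV u).
Hypothesis u_incr : forall x, 0 <= 'D_(b x) u x.
Hypothesis u_strict : forall x, 'D_(b x) u x = 0 -> b x = 0.

Let cu : continuous u.
Proof. by move=> x; exact: differentiable_continuous. Qed.

Let cb : continuous b.
Proof. exact: (C1_continuous b1.1). Qed.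

Lemma flow_lipschitz t :
  exists2 K, 0 <= K & forall x y, `|X t x - X t y| <= K * `|x - y|.
Proof.
have [L L0 bL] := C1_per_lipschitz b1.
have [C C0 HC] := solution_dist L0 bL.
exists (Num.sqrt (d%:R * expR (C * `|t|))) => [|x y]; first exact: sqrtr_ge0.
rewrite -(@ler_pXn2r _ 2) ?nnegrE ?mulr_ge0 ?sqrtr_ge0// exprMn.
rewrite sqr_sqrtr; last first.
  by rewrite mulr_ge0 ?expR_ge0.
have [X0 dX] := flowX x; have [Y0 dY] := flowX y.
have := HC (X^~ x) (X^~ y) dX dY t; rewrite /= X0 Y0 => /le_trans; apply.
rewrite [leRHS]mulrAC ler_wpM2r ?expR_ge0// (le_trans (ler_norm _))//.
by rewrite expr2 dot_norm_le.
Qed.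

Lemma flow_continuous t : continuous (X t).
Proof.
have [K K0 HK] := flow_lipschitz t.
exact: lipschitz_continuous K0 HK.
Qed.

Lemma flow_equilibrium x0 : b x0 = 0 -> forall t, X t x0 = x0.
Proof.
move=> bx0 t; have [X0 dX] := flowX x0.
have [L L0 bL] := C1_per_lipschitz b1.
have [C C0 HC] := solution_dist L0 bL.
have dx0 s : is_derive s (1 : R) (cst x0) (b x0).
  by rewrite bx0; exact: is_derive_cst.
have := HC (X^~ x0) (cst x0) dX dx0 t; rewrite /= X0 subrr.
rewrite (_ : dot 0 0 = 0) ?mul0r; last first.
  by rewrite /dot big1// => i _; rewrite mxE mulr0.
move=> h; apply/eqP; rewrite -subr_eq0 -normr_eq0.
by rewrite -sqrf_eq0 eq_le h sqr_ge0.
Qed.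

Let du_flow x t :
  is_derive t (1 : R) (fun s => u (X s x)) ('D_(b (X t x)) u (X t x)).
Proof.
have [_ dX] := flowX x.
by rewrite deriveE//; exact: (is_derive_comp_curve (dX t) (du _)).
Qed.

Lemma lyapunov_nondecreasing x s t : s <= t -> u (X s x) <= u (X t x).
Proof.
move=> st; apply: (@ger0_derive1_ndecr _ (fun s => u (X s x)) s t) => //.
- by move=> r _; exact: (@ex_derive _ _ _ _ _ _ _ (du_flow x r)).
- by move=> r _; rewrite derive1E (@derive_val _ _ _ _ _ _ _ (du_flow x r)).
- apply: continuous_subspaceT => r.
  apply/differentiable_continuous/derivable1_diffP.
  exact: (@ex_derive _ _ _ _ _ _ _ (du_flow x r)).
Qed.

(** Two symmetric times are compared so that 0 is interior to the interval
    [-1, 1] on which u is constant along the trajectory: the vanishing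
    derivative at time 0 is then Fermat's rule at an interior maximum. *)
Lemma lyapunov_stationary x : u (X 1 x) = u (X (-1) x) -> b x = 0.
Proof.
move=> u11; apply: u_strict; have [X0 _] := flowX x.
have : is_derive (0 : R) (1 : R) (fun s => u (X s x)) 0.
  apply: (derive1_at_max (@lerN1 R)
    (fun t _ => @ex_derive _ _ _ _ _ _ _ (du_flow x t)) (@zero_in_itvN11 R)).
  - move=> t; rewrite in_itv/= => /andP[_ t1].
    rewrite (le_trans (lyapunov_nondecreasing x (ltW t1)))// u11.
    by apply: lyapunov_nondecreasing.
move=> d0; rewrite -[in LHS]X0 -(@derive_val _ _ _ _ _ _ _ (du_flow x 0)).
exact: derive_val.
Qed.

(** At a maximum of u over the torus the derivative of u in the direction b
    vanishes. *)
Lemma lyapunov_equilibrium : exists2 x0, unit_cube x0 & b x0 = 0.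
Proof.
have [x0 cx0 umax] := periodic_max cu pu.
exists x0 => //; apply: u_strict.
have dl t := is_derive_line (x := x0) (h := b x0) (t := t) (du _).
have d0 : is_derive (0 : R) (1 : R) (fun s => u (x0 + s *: b x0)) 0.
  apply: (derive1_at_max (@lerN1 R)
    (fun t _ => @ex_derive _ _ _ _ _ _ _ (dl t)) (@zero_in_itvN11 R)).
  - by move=> t _; rewrite scale0r addr0.
have := @derive_val _ _ _ _ _ _ _ (dl 0); rewrite scale0r addr0 => <-.
exact: derive_val.
Qed.

(** Invariance gives u o X 1 and u o X (-1) the same integral, although the
    former dominates the latter; so they agree almost everywhere, and almost
    every point is stationary. Continuity of the flow makes the difference
    measurable. *)
Lemma invariant_measure_equilibria (mu : probability (borel_rV R d) R) :
  invariant_measures X mu -> ae_eq mu (@unit_cube R d) b (cst 0).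
Proof.
move=> [mu1 muX].
have mC := @measurable_unit_cube R d.
have [M M0 uM] := periodic_bounded cu pu.
have fC : (mu (@unit_cube R d) < +oo)%E by rewrite mu1 ltry.
pose k y := u (X 1 y) - u (X (-1) y).
have cuX t : continuous (fun y => u (X t y)).
  exact: (continuous_composition (@flow_continuous t) cu).
have iuX t := integrable_unit_cube fC (cuX t) (fun y => uM (X t y)).
have ik : mu.-integrable (@unit_cube R d) (EFin \o k).
  by have := integrableB mC (iuX 1) (iuX (-1)).
have k0 : (\int[mu]_(y in @unit_cube R d) `|(k y)%:E| = 0)%E.
  transitivity (\int[mu]_(y in @unit_cube R d) (k y)%:E)%E.
    apply: eq_integral => y _; rewrite gee0_abs//= lee_fin subr_ge0.
    by apply: lyapunov_nondecreasing; exact: lerN1.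
  have := integrable_fin_num mC ik => /fineK <-.
  congr EFin; rewrite -[LHS]/(\int[mu]_(y in @unit_cube R d) k y).
  by rewrite RintegralB// !muX// subrr.
have /(ae_eq_integral_abs mu mC (measurable_int _ ik)) := k0.
apply: filterS => y ky Dy; apply: lyapunov_stationary.
by have := ky Dy => /= -[] /eqP; rewrite subr_eq0 => /eqP.
Qed.

(** Invariant measures are carried by the zeros of b, so they all give b the
    mean 0; the Dirac mass at an equilibrium is one of them. *)
Lemma lyapunov_rotation_set : rotation_set b X = [set 0].
Proof.
have mC := @measurable_unit_cube R d.
apply/seteqP; split => [_ [mu muX <-]|_ ->] /=.
  apply/rowP => i; rewrite !mxE /Rintegral.
  have ci : continuous (fun y => b y ord0 i).
    exact: (continuous_composition cb (@coord_continuous _ _ _ ord0 i)).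
  rewrite (ae_eq_integral (cst 0%E))//.
  - by rewrite integral0.
  - apply: measurable_funTS; apply/measurable_EFinP.
    exact: continuous_measurable_rV.
  - move: (invariant_measure_equilibria muX); apply: filterS => y by0 Dy.
    by rewrite by0//= mxE.
have [x0 cx0 bx0] := lyapunov_equilibrium.
have dx0 (f : 'rV[R]_d -> R) : continuous f ->
    \int[@dirac _ (borel_rV R d) x0 R]_(y in @unit_cube R d) f y = f x0.
  move=> cf; rewrite /Rintegral integral_dirac//; last first.
    apply: measurable_funTS; apply/measurable_EFinP.
    exact: continuous_measurable_rV.
  by rewrite diracE mem_set// mul1e.
exists (@dirac _ (borel_rV R d) x0 R).
  split; first by rewrite /torus_probability /= diracE mem_set.
  move=> t psi cpsi _; rewrite !dx0//; first by rewrite flow_equilibrium.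
  exact: (continuous_composition (@flow_continuous t) cpsi).
apply/rowP => i; rewrite !mxE dx0; first by rewrite bx0 mxE.
exact: (continuous_composition cb (@coord_continuous _ _ _ ord0 i)).
Qed.

End lyapunov.

(** * The linear part of the corrector and the rotation set *)

Lemma dotBl (R : realType) (d : nat) (a b c : 'rV[R]_d) :
  dot (a - b) c = dot a c - dot b c.
Proof.
by rewrite /dot -sumrB; apply: eq_bigr => i _; rewrite !mxE mulrBl.
Qed.

Lemma dot_is_linear (R : realType) (d : nat) (m : 'rV[R]_d) :
  linear (dot m : 'rV[R]_d -> R).
Proof.
move=> a x y; rewrite /dot /GRing.scale /= mulr_sumr -big_split /=.
by apply: eq_bigr => i _; rewrite !mxE; ring.
Qed.

HB.instance Definition _ (R : realType) (d : nat) (m : 'rV[R]_d) :=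
  GRing.isLinear.Build R 'rV[R]_d R _ (dot m) (dot_is_linear m).

Lemma dot_continuous (R : realType) (d : nat) (m : 'rV[R]_d) :
  continuous (dot m).
Proof.
apply: (lipschitz_continuous (K := d%:R * `|m|)) => [|x y].
  by rewrite mulr_ge0.
by rewrite -linearB -mulrA dot_norm_le.
Qed.

Lemma differentiable_dot (R : realType) (d : nat) (m x : 'rV[R]_d) :
  differentiable (dot m) x.
Proof. exact/linear_differentiable/dot_continuous. Qed.

Lemma derive_dot (R : realType) (d : nat) (m x h : 'rV[R]_d) :
  'D_h (dot m) x = dot m h.
Proof.
rewrite deriveE; last exact: differentiable_dot.
by rewrite diff_lin//; exact: dot_continuous.
Qed.

Theorem proposition2p4 (R : realType) (d : nat)
    (v : 'rV[R]_d -> R)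
    (hv : C2 v)
    (hgrad : C1_per (grad v))
    (hfin : finite_set
      [set x | unit_cube x /\ grad v x = torus_mean (grad v)])
    (F : 'rV[R]_d -> 'rV[R]_d -> 'rV[R]_d)
    (hF : C1_C1_per F)
    (hF0 : forall x, F x (torus_mean (grad v)) = 0)
    (hFmono : forall x xi eta, xi != eta ->
      0 < dot (F x xi - F x eta) (xi - eta)) :
  let b := fun x => F x (grad v x) in
  C1_per b /\
  forall X : R -> 'rV[R]_d -> 'rV[R]_d,
    is_flow b X -> rotation_set b X = [set 0].
Proof.
move=> b.
have b1 : C1_per b.
  split; first exact: C1_diag hF _ hgrad.1.
  by move=> x k; rewrite /b hgrad.2; have [-> _ _ _ _] := hF.
split=> // X flowX.
set m := torus_mean (grad v).
pose u x := v x - dot m x.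
have dv x : differentiable v x := hv.1.1 x.
have du x : differentiable u x.
  exact: (differentiableB (dv x) (differentiable_dot m x)).
have Du x h : 'D_h u x = dot (grad v x - m) h.
  have Ev : derivable v x h by exact: diff_derivable.
  have Em : derivable (dot m) x h.
    by apply: diff_derivable; exact: differentiable_dot.
  have -> : 'D_h u x = 'D_h v x - 'D_h (dot m) x by exact: deriveB.
  by rewrite gradE// derive_dot dotBl.
(* b x = F x (grad v x) - F x m because F x m = 0. *)
have uE x : 'D_(b x) u x = dot (F x (grad v x) - F x m) (grad v x - m).
  rewrite Du hF0 subr0.
  by rewrite /dot; apply: eq_bigr => i _; rewrite mulrC.
apply: (lyapunov_rotation_set b1 flowX du).
- exact: (corrector_periodic hv.1 hgrad.2).
- move=> x; rewrite uE; have [->|gm] := eqVneq (grad v x) m.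
    by rewrite !subrr /dot big1// => i _; rewrite !mxE mulr0.
  exact/ltW/hFmono.
- move=> x; rewrite uE => /eqP; have [gm|gm] := eqVneq (grad v x) m.
    by move=> _; rewrite /b gm hF0.
  by rewrite gt_eqF// hFmono.
Qed.
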